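(* If $X$ is a pseudocompact countably $\varkappa$-metrizable (Tychonoff) space, then its Čech–Stone compactification $\beta X$ is $\varkappa$-metrizable.
   Context: All spaces are Tychonoff. For a space $X$, $\mathrm{RC}(X)$ is the set of regular closed subsets of $X$ (sets $A$ with $\mathrm{cl}\,\mathrm{int}\,A=A$). A $\varkappa$-metric on $X$ is a function $\varrho:X\times \mathrm{RC}(X)\to[0,\infty)$ such that: (K1) $\varrho(x,C)=0$ if and only if $x\in C$, for all $x\in X$, $C\in\mathrm{RC}(X)$; (K2) if $C\subseteq D$ then $\varrho(x,C)\ge\varrho(x,D)$, for all $x\in X$, $C,D\in\mathrm{RC}(X)$; (K3) $\varrho(\cdot,C)$ is continuous for every $C\in\mathrm{RC}(X)$; (K4) $\varrho(x,\mathrm{cl}(\bigcup_{\alpha<\lambda}C_\alpha))=\inf_{\alpha<\lambda}\varrho(x,C_\alpha)$ for every non-decreasing totally ordered sequence $\{C_\alpha:\alpha<\lambda\}\subseteq\mathrm{RC}(X)$ and every $x\in X$. A countable $\varkappa$-metric is a function $\varrho:X\times\mathrm{RC}(X)\to[0,\infty)$ satisfying (K1)–(K3) and (K4$_\omega$) $\varrho(x,\mathrm{cl}(\bigcup_{n<\omega}C_n))=\inf_{n<\omega}\varrho(x,C_n)$ for every chain $\{C_n:n<\omega\}\subseteq\mathrm{RC}(X)$ and every $x\in X$. $X$ is $\varkappa$-metrizable (resp. countably $\varkappa$-metrizable) if it admits a $\varkappa$-metric (resp. a countable $\varkappa$-metric). *)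

(* Defs.v *)
From HB Require Import structures.
From mathcomp Require Import all_boot all_order all_algebra.
From mathcomp Require Import all_classical all_reals all_analysis.
From mathcomp Require Import wochoice.

Set Implicit Arguments.
Unset Strict Implicit.
Unset Printing Implicit Defensive.

Import Order.TTheory GRing.Theory Num.Theory.
Import numFieldNormedType.Exports.

Local Open Scope classical_set_scope.
Local Open Scope ring_scope.

Definition tychonoff_space (X : topologicalType) : Prop :=
  accessible_space X /\ completely_regular_space X.

Definition pseudocompact (R : realType) (X : topologicalType) : Prop :=
  forall f : X -> R, continuous f -> bounded_fun f.

Section KappaMetric.
Variables (R : realType) (X : topologicalType).

(* A function X * RC(X) -> [0, oo[ is encoded as a total function
   rho : X -> set X -> R; every axiom below only speaks about its values
   on regular closed sets. *)
Implicit Types rho : X -> set X -> R.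

Definition kappa_nonneg rho : Prop :=
  forall x C, regclosed C -> 0 <= rho x C.

Definition kappa_zero rho : Prop :=
  forall x C, regclosed C -> (rho x C = 0 <-> C x).

Definition kappa_antitone rho : Prop :=
  forall x C D, regclosed C -> regclosed D -> C `<=` D -> rho x D <= rho x C.

Definition kappa_continuous rho : Prop :=
  forall C, regclosed C -> continuous (rho ^~ C).

(* Sequences indexed by an ordinal are families indexed by a well-ordered
   type; it must be inhabited, since the infimum of the empty set of values
   is meaningless in [0, oo[. *)
Definition kappa_chain rho : Prop :=
  forall (I : eqType) (le : rel I) (C : I -> set X) (x : X),
    well_order le -> inhabited I ->
    (forall i, regclosed (C i)) ->
    (forall i j, le i j -> C i `<=` C j) ->
    rho x (closure (\bigcup_i C i)) = inf (range (fun i => rho x (C i))).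

Definition kappa_countable_chain rho : Prop :=
  forall (C : nat -> set X) (x : X),
    (forall n, regclosed (C n)) ->
    total_on (range C) subset ->
    rho x (closure (\bigcup_n C n)) = inf (range (fun n => rho x (C n))).

Definition kappa_metric rho : Prop :=
  [/\ kappa_nonneg rho, kappa_zero rho, kappa_antitone rho,
      kappa_continuous rho & kappa_chain rho].

Definition countable_kappa_metric rho : Prop :=
  [/\ kappa_nonneg rho, kappa_zero rho, kappa_antitone rho,
      kappa_continuous rho & kappa_countable_chain rho].

Definition kappa_metrizable : Prop := exists rho, kappa_metric rho.

Definition countably_kappa_metrizable : Prop :=
  exists rho, countable_kappa_metric rho.

End KappaMetric.

Section StoneCech.

Definition topological_embedding (X Y : topologicalType) (e : X -> Y) : Prop :=
  injective e /\ @open X = [set e @^-1` V | V in @open Y].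

Definition compactification (X Y : topologicalType) (e : X -> Y) : Prop :=
  [/\ compact [set: Y], hausdorff_space Y, topological_embedding e
    & dense (range e)].

(* The pair (bX, e) is determined by X up to a unique homeomorphism under X;
   its existence is stone_cech_exists below. *)
Definition stone_cech (X bX : topologicalType) (e : X -> bX) : Prop :=
  compactification e /\
  forall (K : topologicalType) (f : X -> K),
    compact [set: K] -> hausdorff_space K -> continuous f ->
    exists2 g : bX -> K, continuous g & forall x, g (e x) = f x.

End StoneCech.

Lemma prod_continuous (T : topologicalType) (I : choiceType)
  (U : I -> topologicalType) (F : T -> prod_topology U) :
  (forall i, continuous (fun t => F t i)) -> continuous F.
Proof.
move=> cF x; apply/cvg_sup => i; move: x.
apply/(@continuousP _ (initial_topology (@^~ i))) => A [V oV <-].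
by have /continuousP := cF i; apply.
Qed.

Section StoneCechExists.
Variable R : realType.

Definition unit_funs (X : topologicalType) : set (X -> R) :=
  [set f : X -> R | continuous f /\ forall x, `[0, 1]%classic (f x)].
Arguments unit_funs : clear implicits.

Definition cube (X : topologicalType) : topologicalType :=
  prod_topology (fun _ : unit_funs X => R : topologicalType).

Definition cube_map (X : topologicalType) : X -> cube X :=
  @join_product (unit_funs X : choiceType) X (fun=> R : topologicalType)
    (fun f => set_val f).

Lemma cube_sep (X : topologicalType) : completely_regular_space X ->
  @separate_points_from_closed (unit_funs X : choiceType) X
    (fun=> R : topologicalType) (fun f => set_val f).
Proof.
move=> cr U x cU nUx.
have /(@uniform_separatorP _ R) [f [cf f01 f0 f1]] := cr x U cU nUx.
have ff : unit_funs X f by split => // y; apply: f01; exists y.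
exists (exist _ f (mem_set ff)); rewrite set_valE /=.
have -> : f x = 0 by apply: f0; exists x.
move=> cl0; have : [set (1 : R)] 0.
  have c1 : closed [set (1 : R)].
    exact/accessible_closed_set1/hausdorff_accessible/Rhausdorff.
  by apply: c1; exact: closureS f1 _ cl0.
by move=> /esym/eqP; rewrite oner_eq0.
Qed.

Lemma unit_funs_continuous (X : topologicalType) (f : unit_funs X) :
  continuous (set_val f : X -> R).
Proof. by case: f => f fP; rewrite set_valE; case/set_mem: (fP). Qed.

Lemma unit_funs_range (X : topologicalType) (f : unit_funs X) x :
  `[0, 1]%classic ((set_val f : X -> R) x).
Proof. by case: f => f fP; rewrite set_valE; case/set_mem: (fP). Qed.

Lemma cube_hausdorff (X : topologicalType) : hausdorff_space (cube X).
Proof.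
by apply: (@hausdorff_product (unit_funs X : choiceType)) => ?;
  exact: Rhausdorff.
Qed.

Lemma cube_closure_compact (X : topologicalType) :
  compact (closure (range (@cube_map X))).
Proof.
pose B : set (cube X) := [set f | forall i, `[0, 1]%classic (f i)].
have cB : compact B.
  apply: (@tychonoff (unit_funs X : choiceType) (fun=> R : topologicalType)
    (fun=> `[0, 1]%classic)) => _; exact: segment_compact.
apply: (subclosed_compact (@closed_closure _ _) cB).
rewrite closureE; apply: smallest_sub.
  exact: compact_closed (@cube_hausdorff X) cB.
by move=> _ [x _ <-] i; exact: unit_funs_range.
Qed.

Lemma compact_set_type (Y : topologicalType) (B : set Y) :
  compact B -> compact [set: set_type B].
Proof.
move=> cB F FF _.
pose G := fmap (set_val : B -> Y) F.
have GB : G B.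
  by rewrite /G /fmap /=; apply: filterS filterT => -[y yB] _;
     rewrite set_valE /=; exact: set_mem.
have [y [By Gy]] := cB G _ GB.
exists (exist _ y (mem_set By)); split => // S T FS [_ [[V oV <-] Vy VT]].
have [||z [[s Ss <-] Vz]] := Gy ((set_val : B -> Y) @` S) V.
- by apply: (@filterS _ F _ S _ _ FS) => s Ss; exists s.
- by apply: open_nbhs_nbhs; split => //; rewrite /= set_valE in Vy.
- by exists s; split => //; exact: VT.
Qed.

Lemma hausdorff_set_type (Y : topologicalType) (B : set Y) :
  hausdorff_space Y -> hausdorff_space (set_type B).
Proof.
move=> hY p q pq; apply: val_inj; apply: hY => S T pS qT.
have [||] := pq (set_val @^-1` S) (set_val @^-1` T).
- exact: (@initial_continuous _ _ (set_val : B -> Y)).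
- exact: (@initial_continuous _ _ (set_val : B -> Y)).
- by move=> z [Sz Tz]; exists (set_val z).
Qed.

Lemma stone_cech_exists (X : topologicalType) : tychonoff_space X ->
  exists (bX : topologicalType) (e : X -> bX), stone_cech e.
Proof.
move=> [T1X crX].
pose B := closure (range (@cube_map X)).
have Be x : B (cube_map x) by apply: subset_closure; exists x.
pose e (x : X) : B := exist _ (cube_map x) (mem_set (Be x)).
have ce : continuous (@cube_map X).
  apply: join_product_continuous; first exact: cube_sep.
  exact: unit_funs_continuous.
have ie : set_inj [set: X] (@cube_map X).
  exact: join_product_inj (cube_sep _) _.
have de : dense (range e).
  move=> O [y Oy] [V oV VO]; have Vy : V (\val y) by move: Oy; rewrite -VO.
  rewrite -VO.
  have By : B (\val y) by exact: set_valP.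
  have [|_ [[x _ <-] Vx]] := By V; first by exact: open_nbhs_nbhs.
  exists (e x); split; last by exists x.
  by rewrite /= set_valE.
exists (set_type B), e; split; first split.
- exact/compact_set_type/cube_closure_compact.
- exact/hausdorff_set_type/cube_hausdorff.
- split=> [x y [exy]|]; first by apply: ie => //; rewrite inE.
  rewrite (join_product_initial (cube_sep crX) (@unit_funs_continuous X) ie).
  rewrite eqEsubset; split => [U [V oV <-]|_ [_ [V oV <-] <-]]; last by exists V.
  by exists (set_val @^-1` V) => //; exists V.
- exact: de.
move=> K f cK hK cf.
have crK : completely_regular_space K.
  exact/normal_completely_regular/hausdorff_accessible/hK/compact_normal.
have cKm : continuous (@cube_map K).
  apply: join_product_continuous; first exact: cube_sep.
  exact: unit_funs_continuous.
have iK : set_inj [set: K] (@cube_map K).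
  apply: join_product_inj (cube_sep crK) _; exact: hausdorff_accessible.
have hf (h : unit_funs K) : unit_funs X ((set_val h : K -> R) \o f).
  split; last by move=> x; exact: unit_funs_range.
  by move=> x; apply: continuous_comp; [exact: cf|exact: unit_funs_continuous].
pose fh (h : unit_funs K) : unit_funs X :=
  exist (fun u => u \in unit_funs X) _ (mem_set (hf h)).
pose F (p : cube X) : cube K := fun h => p (fh h).
have cF : continuous F.
  apply: prod_continuous => h.
  exact: (@proj_continuous (unit_funs X : choiceType)
    (fun=> R : topologicalType) (fh h)).
have cl0 : closed (range (@cube_map K)).
  apply: compact_closed; first exact: cube_hausdorff.
  apply: continuous_compact cK; exact: continuous_subspaceT.
have FB (b : B) : range (@cube_map K) (F (set_val b)).
  have : B (set_val b) by exact: set_valP.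
  move: (set_val b); rewrite -/(_ `<=` F @^-1` _) /B closureE.
  apply: smallest_sub; first by apply: preimage_closed cl0 => + _; exact: cF.
  by move=> _ [x _ <-]; exists (f x).
have [g gP] : {g : B -> K | forall b, cube_map (g b) = F (set_val b)}.
  by exists (fun b => s2val (cid2 (FB b))) => b; case: cid2.
exists g; last first.
  by move=> x; apply: iK; rewrite ?inE// gP.
apply/continuous_closedP => A cA.
have -> : g @^-1` A = (F \o set_val) @^-1` (@cube_map K @` A).
  rewrite eqEsubset; split => [b Ab|b [k Ak kb]]; first by exists (g b).
  rewrite /preimage /=; suff -> : g b = k by [].
  by apply: iK; rewrite ?inE// gP kb.
apply: preimage_closed => [b _|].
  apply: continuous_comp; last exact: cF.
  exact: (@initial_continuous _ _ (set_val : B -> cube X)).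
apply: compact_closed; first exact: cube_hausdorff.
apply: continuous_compact; first exact: continuous_subspaceT.
exact: subclosed_compact cA cK _.
Qed.

End StoneCechExists.

(* Main.v *)
(* By pseudocompactness each rho(., C `&` X) extends continuously to beta X, and
   a nonempty zero set of beta X meets X, which gives (K1) for the extension.
   For (K4), Dini's theorem holds on the pseudocompact space X, so countable
   increasing chains in RC(X) have uniformly convergent distance functions. It
   follows that an arbitrary chain has, for every eps, a member eps-close to all
   larger members; taking eps = 1/(n+1) produces a countable subfamily whose
   union is dense in the union of the chain.  Hence (K4) holds on X uniformly in
   x, and a uniform estimate passes from X to beta X by density. *)

Require Import Defs.
From mathcomp Require Import all_boot all_order all_algebra.
From mathcomp Require Import all_classical all_reals all_analysis.
From mathcomp Require Import lra.

Set Implicit Arguments.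
Unset Strict Implicit.
Unset Printing Implicit Defensive.

Import Order.TTheory GRing.Theory Num.Theory.
Import numFieldNormedType.Exports.

Local Open Scope classical_set_scope.
Local Open Scope ring_scope.

(** * Pseudocompact spaces: bounds, Dini's theorem, zero sets *)

Lemma pseudocompact_bound (R : realType) (X : topologicalType) (f : X -> R) :
  pseudocompact R X -> continuous f -> exists M, forall x, `|f x| <= M.
Proof.
move=> pcX /pcX [M [_ fM]]; exists (M + 1) => x.
by apply: fM => //; rewrite ltrDl.
Qed.

(* Otherwise the sum over n of max(0, u_n - eps/2), which is locally finite,
   would be continuous and unbounded. *)
Lemma pseudocompact_dini (R : realType) (X : topologicalType)
    (u : nat -> X -> R) :
  pseudocompact R X ->
  (forall n, continuous (u n)) ->
  (forall x, nonincreasing_seq (u ^~ x)) ->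
  (forall x eps, 0 < eps -> exists n, u n x < eps) ->
  forall eps, 0 < eps -> exists N, forall x, u N x < eps.
Proof.
move=> pcX cu du u0 eps eps0; apply: contrapT => /forallNP big.
have {}big N : exists x, eps <= u N x.
  by have /existsNP[x /negP] := big N; rewrite -leNgt => ?; exists x.
pose d := eps / 2; have d0 : 0 < d by rewrite divr_gt0.
(* Truncating at half of [eps] makes [t n] vanish where [u n] is below [d], yet stay at least [d]
   where [u n] reaches [eps]. *)
pose t n x := Num.max (u n x - d) 0.
have t0 n x : 0 <= t n x by rewrite le_max lexx orbT.
have tz m n x : (m <= n)%N -> u m x < d -> t n x = 0.
  move=> mn umd; apply/max_r; rewrite subr_le0.
  exact: le_trans (du x _ _ mn) (ltW umd).
pose S m x := \sum_(i < m) t i x.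
have Sadd m k x : S (m + k)%N x = S m x + \sum_(i < k) t (m + i)%N x.
  by rewrite /S big_split_ord.
have Stail m k x : u m x < d -> S (m + k)%N x = S m x.
  move=> umd; rewrite Sadd big1 ?addr0// => i _.
  by apply: (tz m) => //; exact: leq_addr.
have Seq m n x : u m x < d -> u n x < d -> S m x = S n x.
  wlog mn : m n / (m <= n)%N => [wl md nd|md _].
    by case/orP: (leq_total m n) => ?; [|symmetry]; exact: wl.
  by rewrite -(subnKC mn) Stail.
have [N NP] := choice (fun x => u0 x d d0).
(* The whole series, cut at an index from which its terms vanish at [x]; by [Seq] any other such cut
   gives the same value. *)
pose H x := S (N x) x.
have cS m : continuous (S m).
  move=> x; rewrite /continuous_at /S.
  elim: m => [|m IH].
    by under eq_fun do rewrite big_ord0; rewrite big_ord0; exact: cvg_cst.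
  under eq_fun do rewrite big_ord_recr/=; rewrite big_ord_recr/=.
  apply: cvgD => //; apply: (@continuous_max R X (fun y => u m y - d) (cst 0)).
    by apply: cvgB; [exact: cu|exact: cvg_cst].
  exact: cvg_cst.
have cH : continuous H.
  move=> x; rewrite /continuous_at.
  apply: cvg_trans (cS (N x) x); apply: near_eq_cvg.
  (* Near [x] the cut [N x] still works, so [H] agrees there with the finite sum [S (N x)]. *)
  apply: filterS (cvgr_lt _ (cu (N x) x) _ (NP x)) => y Nxy.
  exact: Seq.
have [M HM] := pseudocompact_bound pcX cH.
(* Where [u k] reaches [eps], the first [k] terms are each at least [d] by monotonicity, so this [k]
   pushes [H] above its bound. *)
have [k kM] : exists k : nat, M < k%:R * d.
  exists (Num.truncn (M / d)).+1; rewrite -ltr_pdivrMr//; exact: truncnS_gt.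
have [x ex] := big k.
have kN : (k <= N x)%N.
  rewrite leqNgt; apply/negP => /ltnW/(du x) /=.
  apply/negP; rewrite -ltNge; apply: lt_le_trans ex.
  by apply: lt_trans (NP x) _; rewrite ltr_pdivrMr// ltr_pMr// ltr1n.
have : k%:R * d <= H x.
  rewrite /H -(subnKC kN) Sadd; apply: ler_wpDr; first exact: sumr_ge0.
  rewrite mulr_natl -[k in d *+ k]card_ord -sumr_const; apply: ler_sum => i _.
  rewrite le_max; apply/orP; left.
  have := du x _ _ (ltnW (ltn_ord i)); rewrite /= /d; lra.
have := HM x; have := ler_norm (H x); lra.
Qed.

(** Without a zero on the image of [e], the inverse of [g \o e] would be continuous, hence bounded,
    whereas by density [g] takes values arbitrarily close to [g p = 0] on that image. *)
Lemma pseudocompact_zero (R : realType) (X Y : topologicalType) (e : X -> Y)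
    (g : Y -> R) (p : Y) :
  pseudocompact R X -> continuous e -> dense (range e) -> continuous g ->
  (forall x, 0 <= g x) -> g p = 0 -> exists x, g (e x) = 0.
Proof.
move=> pcX ce de cg g0 gp; apply: contrapT => /forallNP gn.
have cge : continuous (g \o e).
  by move=> x; apply: continuous_comp; [exact: ce|exact: cg].
have cv : continuous (fun x => (g (e x))^-1).
  by move=> x; apply: cvgV; [exact/eqP|exact: cge].
have [M gM] := pseudocompact_bound pcX cv.
pose d := (Num.max M 1)^-1.
have d0 : 0 < d by rewrite invr_gt0 lt_max ltr01 orbT.
have [q [/= qd [x _ xq]]] : ((g @^-1` [set z | z < d]) `&` range e) !=set0.
  apply: de; first by exists p; rewrite /= gp.
  by apply: open_comp; [move=> *; exact: cg|exact: open_lt].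
rewrite -xq in qd.
have gx : 0 < g (e x) by rewrite lt_neqAle g0 andbT eq_sym; exact/eqP.
have := gM x; rewrite ger0_norm ?invr_ge0// => xM.
move: qd; apply/negP; rewrite -leNgt /d -[leRHS]invrK lef_pV2 ?posrE ?invr_gt0//.
  by rewrite le_max xM.
by rewrite lt_max ltr01 orbT.
Qed.

(** * Density arguments and traces of regular closed sets *)

Lemma dense_le (R : realType) (X Y : topologicalType) (e : X -> Y)
    (g h : Y -> R) :
  dense (range e) -> continuous g -> continuous h ->
  (forall x, g (e x) <= h (e x)) -> forall y, g y <= h y.
Proof.
move=> de cg ch gh y; rewrite leNgt; apply/negP => hg.
have [q [/= qd [x _ xq]]] :
    (((fun z => h z - g z) @^-1` [set z | z < 0]) `&` range e) !=set0.
  apply: de; first by exists y; rewrite /= subr_lt0.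
  by apply: open_comp; [move=> z _; apply: cvgB; [exact: ch|exact: cg]
                       |exact: open_lt].
by move: qd; rewrite -xq subr_lt0 ltNge gh.
Qed.

(** Trades the union for an open set, to which facts about closures of open sets apply. *)
Lemma closure_bigcup_interior (X : topologicalType) (I : Type)
    (C : I -> set X) : (forall i, regclosed (C i)) ->
  closure (\bigcup_i C i) = closure (\bigcup_i (C i)°).
Proof.
move=> rC; rewrite eqEsubset; split; last first.
  apply: closure_subset => x [i _ Cx]; exists i => //; exact: interior_subset.
rewrite [X in X `<=` _]closureE; apply: smallest_sub; first exact: closed_closure.
move=> x [i _]; rewrite -[C i]rC; apply: closure_subset => y Cy.
by exists i.
Qed.

Lemma regclosed_closure_bigcup (X : topologicalType) (I : Type)
    (C : I -> set X) : (forall i, regclosed (C i)) ->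
  regclosed (closure (\bigcup_i C i)).
Proof.
move=> rC; rewrite closure_bigcup_interior//; apply: closure_open_regclosed.
by apply: bigcup_open => i _; exact: open_interior.
Qed.

Section DenseEmbedding.
Variables (X Y : topologicalType) (e : X -> Y).
Hypotheses (emb : topological_embedding e) (de : dense (range e)).

Lemma embedding_continuous : continuous e.
Proof.
apply/continuousP => V oV; case: emb => _ ->; by exists V.
Qed.

(** A neighbourhood of [x] is the trace of an open [W']; if [W'] meets [U], then by density it does
    so at a point of the image of [e]. *)
Lemma preimage_closure_open (U : set Y) : open U ->
  e @^-1` (closure U) = closure (e @^-1` U).
Proof.
move=> oU; rewrite eqEsubset; split=> [x ecl V|x cl V Vex]; last first.
  have [y [Uy Vy]] := cl _ (embedding_continuous Vex).
  by exists (e y).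
rewrite nbhsE => -[W [oW Wx] WV].
have [W' oW' eW'] : [set e @^-1` V | V in @open Y] W by case: emb => _ <-.
have [||z [[Uy W'y] [y _ ye]]] := de (O := U `&` W').
- apply: ecl; apply: open_nbhs_nbhs; split => //.
  by rewrite -[W' _]/((e @^-1` W') x) eW'.
- exact: openI.
rewrite -ye in Uy W'y.
exists y; split => //; apply: WV; by rewrite -eW'.
Qed.

Lemma regclosed_preimage (F : set Y) : regclosed F -> regclosed (e @^-1` F).
Proof.
move=> <-; rewrite preimage_closure_open; last exact: open_interior.
apply: closure_open_regclosed; apply: open_comp; last exact: open_interior.
by move=> *; exact: embedding_continuous.
Qed.

(** Lets an estimate for the limit of the traced chain in [X] be read as one for the limit of the
    chain in [Y]. *)
Lemma preimage_closure_bigcup (I : Type) (C : I -> set Y) :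
  (forall i, regclosed (C i)) ->
  e @^-1` (closure (\bigcup_i C i)) = closure (\bigcup_i e @^-1` C i).
Proof.
move=> rC; rewrite (closure_bigcup_interior rC) preimage_closure_open; last first.
  by apply: bigcup_open => i _; exact: open_interior.
rewrite (closure_bigcup_interior (fun i => regclosed_preimage (rC i))).
rewrite preimage_bigcup.
rewrite eqEsubset; split.
  apply: closure_subset => x [i _ Cx]; exists i => //.
  exact: embedding_continuous.
rewrite [X in X `<=` _]closureE; apply: smallest_sub; first exact: closed_closure.
move=> x [i _ /interior_subset]; rewrite /= -[C i]rC.
rewrite -[closure _ _]/((e @^-1` closure _) x) preimage_closure_open; last first.
  exact: open_interior.
apply: closure_subset => y Cy; by exists i.
Qed.

End DenseEmbedding.

(** * Uniform approximation along chains of regular closed sets *)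

Section CountableKappaMetric.
Variables (R : realType) (X : topologicalType) (rho : X -> set X -> R).
Hypotheses (pcX : pseudocompact R X) (rhoP : countable_kappa_metric rho).

Lemma countable_chain_approx (C : nat -> set X) :
  (forall n, regclosed (C n)) -> total_on (range C) subset ->
  forall x eps, 0 < eps ->
  exists n, rho x (C n) < rho x (closure (\bigcup_n C n)) + eps.
Proof.
case: rhoP => nn _ _ _ K4 rC tC x eps eps0; rewrite K4//.
have [|_ [n _ <-] ne] :=
  @inf_adherent _ (range (fun n => rho x (C n))) _ eps0; last by exists n.
split; first by exists (rho x (C 0%N)), 0%N.
by exists 0 => _ [n _ <-]; exact: nn.
Qed.

Variables (I : Type) (i0 : I) (C : I -> set X).
Hypothesis rC : forall i, regclosed (C i).
Hypothesis tC : forall i j, C i `<=` C j \/ C j `<=` C i.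

(* A failure yields an increasing sequence in the chain whose distance
   functions are not uniformly Cauchy, against Dini's theorem. *)
Lemma chain_uniformly_cauchy (eps : R) : 0 < eps ->
  exists i, forall j, C i `<=` C j -> forall x, rho x (C i) <= rho x (C j) + eps.
Proof.
case: (rhoP) => nn _ anti cont _ eps0; apply: contrapT => /forallNP bad.
pose jump i j := C i `<=` C j /\ exists x, rho x (C j) + eps < rho x (C i).
have nextj i : {j | jump i j}.
  apply: cid; have /existsNP[j /not_implyP[Cij /existsNP[x /negP]]] := bad i.
  by rewrite -ltNge => ?; exists j; split => //; exists x.
have [s [_ sP]] := dependent_choice nextj i0.
have smono : {homo (C \o s) : m n / (m <= n)%N >-> m `<=` n}.
  apply: homo_leq => [?|D A E|n]; [exact: subset_refl|exact: subset_trans|].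
  by case: (sP n).
pose D := closure (\bigcup_n C (s n)).
have rD : regclosed D by exact: regclosed_closure_bigcup.
have sD n : C (s n) `<=` D by move=> x Cx; apply: subset_closure; exists n.
(* These differences decrease to 0 pointwise; once they are all below [eps], no further drop by more
   than [eps] is possible. *)
have [|||N NP] := @pseudocompact_dini R X
    (fun n x => rho x (C (s n)) - rho x D) pcX _ _ _ _ eps0.
- by move=> n x; apply: cvgB; exact: cont.
- by move=> x m n mn; rewrite lerD2r; apply: anti => //; exact: smono.
- move=> x d d0; have [||n nd] := @countable_chain_approx (C \o s) _ _ x d d0.
  + by move=> n; exact: rC.
  + by move=> _ _ [m _ <-] [n _ <-]; exact: tC.
  + by exists n; rewrite ltrBlDl.
have [_ [x xN]] := sP N.
have := NP x; have := anti x _ _ (rC _) rD (sD N.+1); lra.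
Qed.

(* The members i_n that are 1/(n+1)-close to everything above them have a union
   dense in the union of the whole chain. *)
Lemma chain_approx_uniform (eps : R) : 0 < eps ->
  exists i, forall x, rho x (C i) <= rho x (closure (\bigcup_i C i)) + eps.
Proof.
case: (rhoP) => nn zero anti _ _ eps0.
have inv0 n : 0 < n.+1%:R^-1 :> R by rewrite invr_gt0.
have [s sP] := choice (fun n => chain_uniformly_cauchy (inv0 n)).
have small (d : R) : 0 < d -> exists n, n.+1%:R^-1 < d.
  move=> d0; exists (Num.truncn d^-1).
  by rewrite -[ltRHS]invrK ltf_pV2 ?posrE ?invr_gt0// truncnS_gt.
pose D := closure (\bigcup_n C (s n)).
have rD : regclosed D by exact: regclosed_closure_bigcup.
have sD n : C (s n) `<=` D by move=> x Cx; apply: subset_closure; exists n.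
have CD j : C j `<=` D.
  have [[n jn]|/forallNP nj] := pselect (exists n, C j `<=` C (s n)).
    exact: subset_trans jn (sD n).
  (* Now [C j] lies above every [C (s n)], so for [y] in [C j] the distance to [D] is at most each
     [1/(n+1)], and (K1) puts [y] in [D]. *)
  have {}nj n : C (s n) `<=` C j by case: (tC j (s n)) => // /nj.
  move=> y Cy; apply/(zero y D rD)/eqP; rewrite eq_le nn// andbT.
  apply/ler_addgt0Pr => d /small[n nd]; rewrite add0r.
  apply: le_trans (anti y _ _ (rC _) rD (sD n)) _.
  by apply: le_trans (sP n j (nj n) y) _; rewrite (zero y _ (rC j)).2// add0r ltW.
have -> : closure (\bigcup_i C i) = D.
  rewrite eqEsubset; split; last first.
    by apply: closure_subset => x [n _ Cx]; exists (s n).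
  rewrite [X in X `<=` _]closureE; apply: smallest_sub.
    exact: closed_closure.
  by move=> x [i _ Cx]; exact: CD Cx.
have [n ne] := small _ eps0; exists (s n) => x.
apply/ler_addgt0Pr => d d0.
have [||m md] := @countable_chain_approx (C \o s) _ _ x d d0.
- by move=> k; exact: rC.
- by move=> _ _ [k _ <-] [l _ <-]; exact: tC.
have {md} : rho x (C (s m)) < rho x D + d by [].
(* If [C (s m)] is the larger set, the choice of [s n] bounds the loss by [eps]; otherwise
   antitonicity suffices. *)
case: (tC (s n) (s m)) => [/(sP n)/(_ x)/le_trans/(_ (lerD (lexx _) (ltW ne)))|/(anti x _ _ (rC _) (rC _))]; lra.
Qed.

End CountableKappaMetric.

(** * Extending the metric to the Čech-Stone compactification *)

(** The universal property needs a compact target; boundedness lets [f] land in the segment from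
    [-M] to [M]. *)
Lemma stone_cech_extend (R : realType) (X bX : topologicalType) (e : X -> bX)
    (f : X -> R) :
  stone_cech e -> pseudocompact R X -> continuous f ->
  exists2 g : bX -> R, continuous g & forall x, g (e x) = f x.
Proof.
move=> [_ ext] pcX cf; have [M fM] := pseudocompact_bound pcX cf.
pose B : set R := `[- M, M]%classic.
have fB x : B (f x) by rewrite /B /= in_itv/= -ler_norml.
pose f' (x : X) : B := exist _ (f x) (mem_set (fB x)).
have cf' : continuous f' by apply: continuous_comp_initial.
have [||g cg gf] := ext (set_type B) f' _ _ cf'.
- exact/compact_set_type/segment_compact.
- exact/hausdorff_set_type/Rhausdorff.
exists (set_val \o g); last by move=> x; rewrite /= gf set_valE.
move=> y; apply: continuous_comp; first exact: cg.
exact: (@initial_continuous _ _ (set_val : B -> R)).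
Qed.

Theorem theorem3p5 (R : realType) (X bX : topologicalType) (e : X -> bX)
    (tychX : tychonoff_space X) (pcX : pseudocompact R X)
    (ckX : countably_kappa_metrizable R X) (scX : stone_cech e) :
  kappa_metrizable R bX.
Proof.
have [[cptB hausB emb de] _] := scX.
have ce := embedding_continuous emb.
have [rho rhoP] := ckX; have [nn zero anti cont _] := rhoP.
have crB : completely_regular_space bX.
  exact/normal_completely_regular/hausdorff_accessible/hausB/compact_normal.
have pre C := @regclosed_preimage _ _ _ emb de C.
have /choice[sig sigP] : forall C : set bX, exists g : bX -> R, regclosed C ->
    continuous g /\ forall x, g (e x) = rho x (e @^-1` C).
  (* The zero function is a dummy value off the regular closed sets. *)
  move=> C; have [rC|nrC] := pselect (regclosed C); last by exists (cst 0).
  have [g cg ge] := stone_cech_extend scX pcX (cont _ (pre _ rC)).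
  by exists g.
have csig C rC := (sigP C rC).1; have sige C rC := (sigP C rC).2.
have signn C p : regclosed C -> 0 <= sig C p.
  move=> rC; apply: (dense_le (g := cst 0) de) (csig _ rC) _ _.
    by move=> ?; exact: cvg_cst.
  by move=> x; rewrite sige//; apply: nn; exact: pre.
have santi p C D : regclosed C -> regclosed D -> C `<=` D -> sig D p <= sig C p.
  move=> rC rD CD; apply: (dense_le de) (csig _ rD) (csig _ rC) _ _ => x.
  rewrite !sige//; apply: anti; [exact: pre|exact: pre|by move=> y /CD].
exists (fun p C => sig C p); split => //.
- by move=> p C; exact: signn.
- move=> p C rC; have oC : open C° by exact: open_interior.
  split=> [sp|]; last first.
    rewrite -{1}rC => Cp; apply/eqP; rewrite eq_le signn// andbT leNgt.
    apply/negP => sp.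
    (* This nonempty open set would contain a point of [X] lying in [C] at positive distance from
       it. *)
    have [y [Cy sy]] : (C° `&` (sig C @^-1` [set z | 0 < z])) !=set0.
      apply: Cp; apply: open_nbhs_nbhs; split => //.
      by apply: open_comp; [move=> *; exact: csig|exact: open_gt].
    have [||y' [[/interior_subset Cx sx] [x _ xe]]] :=
      de (C° `&` (sig C @^-1` [set z | 0 < z])).
    + by exists y.
    + apply: openI => //.
      by apply: open_comp; [move=> *; exact: csig|exact: open_gt].
    rewrite -xe in Cx sx; move: sx; rewrite /= sige//.
    by rewrite (zero x _ (pre _ rC)).2// ltxx.
  apply: contrapT => Cp.
  have cC : closed C by rewrite -rC; exact: closed_closure.
  (* Here [g] is 0 at [p] and 1 on [C]. The sum [g + sig C] vanishes at [p], hence at some [e x];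
     then [e x] lies in [C] although [g (e x) = 0]. *)
  have /(@uniform_separatorP _ R)[g [cg g01 g0 g1]] := crB p C cC Cp.
  have gnn y : 0 <= g y.
    by have /= := g01 (g y); rewrite in_itv/= => /(_ _)/andP[]//; exists y.
  have [|||x /eqP] :=
    @pseudocompact_zero R X bX e (fun y => g y + sig C y) p pcX ce de.
  + by move=> y; apply: cvgD; [exact: cg|exact: csig].
  + by move=> y; rewrite addr_ge0 ?signn.
  + by rewrite sp addr0; apply: g0; exists p.
  rewrite paddr_eq0 ?signn// sige// => /andP[/eqP gx /eqP /(zero x _ (pre _ rC)) Cx].
  have := g1 (g (e x)) (ex_intro2 _ _ (e x) Cx erefl).
  by rewrite /= gx => /esym/eqP; rewrite oner_eq0.
- move=> I le C p wo [i0] rC Cmono.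
  have tC i j : C i `<=` C j \/ C j `<=` C i.
    (* Totality comes from the least element of the pair. *)
    have [|z [[zij zmin] _]] := wo (pred2 i j); first by exists i; exact: predU1l.
    case/pred2P: zij zmin => -> zmin; [left|right]; apply/Cmono/zmin.
      exact: predU1r.
    exact: predU1l.
  have rU : regclosed (closure (\bigcup_i C i)) by exact: regclosed_closure_bigcup.
  have lb i : sig (closure (\bigcup_i C i)) p <= sig (C i) p.
    by apply: santi => // x Cx; apply: subset_closure; exists i.
  apply/eqP; rewrite eq_le; apply/andP; split.
    apply: lb_le_inf; first by exists (sig (C i0) p), i0.
    by move=> _ [i _ <-]; exact: lb.
  apply/ler_addgt0Pr => eps eps0.
  have [||i iP] := @chain_approx_uniform R X rho pcX rhoP I i0
      (fun i => e @^-1` C i) _ _ eps eps0.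
  - by move=> i; exact: pre.
  - by move=> i j; case: (tC i j) => h; [left|right] => x /h.
  apply: (@le_trans _ _ (sig (C i) p)).
    apply: ge_inf; last by exists i.
    by exists 0 => _ [j _ <-]; exact: signn.
  (* The index [i] serves all points of [X] at once, so the inequality passes to [p] by density. *)
  apply: (dense_le (h := fun q => sig (closure (\bigcup_i C i)) q + eps) de)
    (csig _ (rC i)) _ _ _.
    by move=> q; apply: cvgD; [exact: csig|exact: cvg_cst].
  move=> x; rewrite /= !sige// preimage_closure_bigcup//.
Qed.
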